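(* Let $D$ be any weighted oriented graph. If $I_D$ is generalized robust or weakly robust, then $D$ has no subgraph of type $D_1$ and no subgraph of type $D_2$.
   Context: A weighted oriented graph $D=(V(D),E(D),\mathbf{w})$ has a finite simple underlying graph (no loops, no multiple edges) with $V(D)=\{x_1,\dots,x_p\}$; each edge is an ordered pair $(x_i,x_j)$ oriented from its tail $x_i$ to its head $x_j$; $\mathbf{w}:V(D)\to\mathbb{N}=\{1,2,\dots\}$ is a weight function, $w_i=\mathbf{w}(x_i)$. Let $K$ be a field. The toric ideal $I_D\subset K[e:e\in E(D)]$ is the kernel of the $K$-algebra homomorphism $K[e:e\in E(D)]\to K[x_1,\dots,x_p]$ sending the variable $e=(x_i,x_j)$ to $x_ix_j^{w_j}$. The incidence matrix $A(D)$ has rows indexed by vertices and columns by edges; the entry at (vertex $x_i$, edge $e$) is $1$ if $x_i$ is the tail of $e$, $w_i$ if $x_i$ is the head of $e$, and $0$ otherwise. Subgraphs (not necessarily induced; in particular cycles, which are cycles of the underlying undirected graph) carry the inherited orientation and weights. Binomials are identified with their negatives. A binomial $\mathbf{e}^{\mathbf{u}}-\mathbf{e}^{\mathbf{v}}\in I_D$ is primitive if there is no other binomial $\mathbf{e}^{\mathbf{u}'}-\mathbf{e}^{\mathbf{v}'}\in I_D$ (nonzero) with $\mathbf{e}^{\mathbf{u}'}\mid\mathbf{e}^{\mathbf{u}}$ and $\mathbf{e}^{\mathbf{v}'}\mid\mathbf{e}^{\mathbf{v}}$. $Gr_D$ (Graver basis) is the set of primitive binomials of $I_D$; $\mathcal{U}_D$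 (universal Gröbner basis) is the union of all reduced Gröbner bases of $I_D$ over all term orders; $\mathcal{M}_D$ (universal Markov basis) is the union of all minimal binomial generating sets of $I_D$. The ideal $I_D$ is generalized robust if $\mathcal{U}_D=\mathcal{M}_D$; weakly robust if $Gr_D=\mathcal{M}_D$. A cycle $\mathcal{C}$ is balanced if $\det A(\mathcal{C})=0$ and unbalanced otherwise. Cycles share an edge $e$ means that any two of them intersect exactly in $e$ and its two end vertices. A weighted oriented graph is of type $D_1$ if it consists of two balanced cycles $\mathcal{C}_1,\mathcal{C}_2$ that share an edge $e$. It is of type $D_2$ if it consists of three cycles $\mathcal{C}_1,\mathcal{C}',\mathcal{C}''$ that share an edge $e$, where $\mathcal{C}_1$ is balanced, $\mathcal{C}'$ and $\mathcal{C}''$ are unbalanced, and the cycle $\mathcal{C}'''$ with edge set $(E(\mathcal{C}')\cup E(\mathcal{C}''))\setminus\{e\}$ is also unbalanced. *)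

(* Defs.v *)
From mathcomp Require Import all_boot all_order all_algebra.
From mathcomp.multinomials Require Import mpoly.

Set Implicit Arguments.
Unset Strict Implicit.
Unset Printing Implicit Defensive.

Import GRing.Theory.
Local Open Scope ring_scope.

(* Graphs live inside an ambient finite type T of vertex names, so that a graph
   and its subgraphs have the same type.  An edge is a pair (tail, head). *)
Record wograph (T : finType) := WOGraph {
  vertices : {set T};
  edges : {set T * T};
  weight : T -> nat;
  edge_ends : forall e, e \in edges -> (e.1 \in vertices) && (e.2 \in vertices);
  loopless : forall x, (x, x) \notin edges;
  no_antiparallel : forall x y, (x, y) \in edges -> (y, x) \notin edges;
  weight_gt0 : forall x, x \in vertices -> (0 < weight x)%N
}.

Section Graphs.
Variable T : finType.
Implicit Types (G H C D : wograph T) (e : T * T).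

Definition subgraph H G : Prop :=
  [/\ vertices H \subset vertices G,
      edges H \subset edges G
    & {in vertices H, weight H =1 weight G}].

Definition adjacent G (x y : T) : bool :=
  ((x, y) \in edges G) || ((y, x) \in edges G).

(* s lists the vertices in cyclic order: orientations are ignored. *)
Definition is_cycle C : Prop :=
  exists s : seq T,
    [/\ uniq s, (3 <= size s)%N, vertices C = [set x in s]
      & forall x y, adjacent C x y =
          [&& x \in s, y \in s & (next s x == y) || (next s y == x)]].

Definition incidence_entry G (x : T) e : nat :=
  if x == e.1 then 1%N else if x == e.2 then weight G x else 0%N.

Definition incidence_mx G : 'M[int]_(#|vertices G|, #|edges G|) :=
  \matrix_(i, j) (incidence_entry G (enum_val i) (enum_val j))%:Z.

(* The cast makes the matrix square, which it is for a cycle.  Reordering rows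
   or columns only changes the sign of the determinant. *)
Definition balanced C : Prop :=
  exists eqEV : #|edges C| = #|vertices C|,
    \det (castmx (erefl _, eqEV) (incidence_mx C)) = 0.

Definition balanced_cycle C : Prop := is_cycle C /\ balanced C.
Definition unbalanced_cycle C : Prop := is_cycle C /\ ~ balanced C.

Definition share_edge C1 C2 e : Prop :=
  edges C1 :&: edges C2 = [set e]
  /\ vertices C1 :&: vertices C2 = [set e.1; e.2].

Definition type_D1 G : Prop :=
  exists C1 C2 e,
    [/\ subgraph C1 G /\ subgraph C2 G,
        vertices G = vertices C1 :|: vertices C2,
        edges G = edges C1 :|: edges C2,
        share_edge C1 C2 e
      & balanced_cycle C1 /\ balanced_cycle C2].

Definition type_D2 G : Prop :=
  exists C1 C' C'' e,
    [/\ [/\ subgraph C1 G, subgraph C' G & subgraph C'' G],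
        vertices G = vertices C1 :|: vertices C' :|: vertices C'',
        edges G = edges C1 :|: edges C' :|: edges C'',
        [/\ share_edge C1 C' e, share_edge C1 C'' e & share_edge C' C'' e]
      & [/\ balanced_cycle C1, unbalanced_cycle C', unbalanced_cycle C''
          & exists C''', [/\ subgraph C''' G,
              edges C''' = (edges C' :|: edges C'') :\ e
            & unbalanced_cycle C''']]].

End Graphs.

Section Ideals.
Variables (K : fieldType) (n : nat).
Notation poly := {mpoly K[n]}.
Implicit Types (I S B : poly -> Prop) (le : rel 'X_{1..n}) (f g : poly).

Definition gen_ideal S f : Prop :=
  exists s : seq (poly * poly),
    (forall q, q \in s -> S q.2) /\ f = \sum_(q <- s) q.1 * q.2.

Definition binomial (u v : 'X_{1..n}) : poly := 'X_[u] - 'X_[v].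

Definition primitive I (u v : 'X_{1..n}) : Prop :=
  [/\ u != v, I (binomial u v)
    & forall u' v', u' != v' -> I (binomial u' v') ->
        (u' <= u)%MM -> (v' <= v)%MM -> (u', v') = (u, v)].

Definition graver_basis I f : Prop :=
  exists u v, f = binomial u v /\ primitive I u v.

Definition term_order le : Prop :=
  [/\ total le, antisymmetric le, transitive le, forall u, le 0%MM u
    & forall w u v, le u v -> le (u + w)%MM (v + w)%MM].

Definition is_lead le f (m : 'X_{1..n}) : Prop :=
  m \in msupp f /\ forall m', m' \in msupp f -> le m' m.

Definition lead_monomials le S (q : poly) : Prop :=
  exists f m, [/\ S f, is_lead le f m & q = 'X_[m]].

Definition initial_ideal le I : poly -> Prop :=
  gen_ideal (lead_monomials le I).

Definition groebner_basis le I (G : seq poly) : Prop :=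
  (forall g, g \in G -> I g)
  /\ forall f, initial_ideal le I f
       <-> gen_ideal (lead_monomials le (fun g => g \in G)) f.

Definition reduced_groebner_basis le I (G : seq poly) : Prop :=
  [/\ groebner_basis le I G,
      forall g, g \in G -> exists2 m, is_lead le g m & g@_m = 1
    & forall g h m m', g \in G -> h \in G -> g != h ->
        is_lead le g m -> m' \in msupp h -> ~~ (m <= m')%MM].

Definition universal_groebner_basis I f : Prop :=
  exists le G, [/\ term_order le, reduced_groebner_basis le I G & f \in G].

Definition generates S I : Prop := forall f, gen_ideal S f <-> I f.

Definition minimal_binomial_generating_set I B : Prop :=
  [/\ forall f, B f -> exists u v, u != v /\ f = binomial u v,
      generates B I
    & forall B', (forall f, B' f -> B f) -> generates B' I ->
        forall f, B f -> B' f].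

Definition universal_markov_basis I f : Prop :=
  exists2 B, minimal_binomial_generating_set I B & B f.

(* Binomials are identified with their negatives. *)
Definition same_up_to_sign S S' : Prop :=
  forall f, (S f \/ S (- f)) <-> (S' f \/ S' (- f)).

End Ideals.

Section ToricIdeals.
Variables (K : fieldType) (T : finType) (D : wograph T).

Lemma tail_in (j : 'I_#|edges D|) : (enum_val j).1 \in vertices D.
Proof. by case/andP: (edge_ends (enum_valP j)). Qed.

Lemma head_in (j : 'I_#|edges D|) : (enum_val j).2 \in vertices D.
Proof. by case/andP: (edge_ends (enum_valP j)). Qed.

(* The vertex and edge variables are numbered by the enumerations of
   [vertices D] and [edges D]. *)
Definition tail_index (j : 'I_#|edges D|) : 'I_#|vertices D| :=
  enum_rank_in (tail_in j) (enum_val j).1.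

Definition head_index (j : 'I_#|edges D|) : 'I_#|vertices D| :=
  enum_rank_in (head_in j) (enum_val j).2.

Definition edge_image (j : 'I_#|edges D|) : {mpoly K[#|vertices D|]} :=
  'X_(tail_index j) * 'X_(head_index j) ^+ weight D (enum_val j).2.

Definition toric_ideal (f : {mpoly K[#|edges D|]}) : Prop :=
  f \mPo [tuple edge_image j | j < #|edges D|] = 0.

Definition generalized_robust : Prop :=
  same_up_to_sign (universal_groebner_basis toric_ideal)
                  (universal_markov_basis toric_ideal).

Definition weakly_robust : Prop :=
  same_up_to_sign (graver_basis toric_ideal)
                  (universal_markov_basis toric_ideal).

End ToricIdeals.

(* Main.v *)
(** Both notions of robustness force every circuit [z] of [D], that is, every
    generator of the kernel vectors of the incidence matrix supported in a minimal
    set, to give a binomial of some minimal generating set: a circuit is primitive,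
    and it lies in a reduced Groebner basis for an order eliminating the other
    variables.  If a balanced cycle shares the edge [e] with another balanced cycle
    (type D1), or with a pair of unbalanced cycles (type D2), then gluing the two
    kernel vectors so as to cancel [e] gives such a circuit.  Its part [h] on the
    first cycle, completed at [e], is again an integral kernel vector because the
    tail of [e] has incidence entry 1.  With the sign chosen so that [h e > 0], the
    monomials [z^-], [z^- + h], [z^+] have the same image and consecutive ones share
    a variable, so the binomial is generated in lower degree and lies in no minimal
    generating set. *)

From mathcomp Require Import all_boot all_order all_algebra.
From mathcomp.multinomials Require Import mpoly.
From mathcomp Require Import zify.
From Stdlib Require Import Classical.
Require Import Defs.

Set Implicit Arguments.
Unset Strict Implicit.
Unset Printing Implicit Defensive.

Import Order.TTheory GRing.Theory Num.Theory.
Local Open Scope ring_scope.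

(** * Closure properties of generated ideals *)

Section GenIdeal.
Variables (K : fieldType) (n : nat).
Notation poly := {mpoly K[n]}.
Implicit Types (S : poly -> Prop) (f g : poly).

Lemma gen_ideal0 S : gen_ideal S 0.
Proof. by exists [::]; split=> //; rewrite big_nil. Qed.

Lemma gen_idealD S f g : gen_ideal S f -> gen_ideal S g -> gen_ideal S (f + g).
Proof.
move=> [s [Ss ->]] [t [St ->]]; exists (s ++ t); split; last by rewrite big_cat.
by move=> q; rewrite mem_cat => /orP[/Ss|/St].
Qed.

Lemma gen_idealM S f g : gen_ideal S g -> gen_ideal S (f * g).
Proof.
move=> [s [Ss ->]]; exists [seq (f * q.1, q.2) | q <- s]; split.
  by move=> q /mapP[r /Ss Sr ->].
by rewrite big_map mulr_sumr; apply: eq_bigr => q _; rewrite mulrA.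
Qed.

Lemma gen_ideal_mem S f : S f -> gen_ideal S f.
Proof.
move=> Sf; exists [:: (1, f)]; split; last by rewrite big_seq1 mul1r.
by move=> q; rewrite inE => /eqP->.
Qed.

Lemma gen_ideal_sum S (I : eqType) (s : seq I) (F : I -> poly) :
  (forall i, i \in s -> gen_ideal S (F i)) -> gen_ideal S (\sum_(i <- s) F i).
Proof.
elim: s => [|i s IHs] SF; first by rewrite big_nil; apply: gen_ideal0.
rewrite big_cons; apply: gen_idealD; first by apply: SF; rewrite mem_head.
by apply: IHs => j sj; apply: SF; rewrite inE sj orbT.
Qed.

Lemma gen_ideal_trans S (S' : poly -> Prop) f :
  (forall g, S g -> gen_ideal S' g) -> gen_ideal S f -> gen_ideal S' f.
Proof.
move=> SS' [s [Ss ->]]; apply: gen_ideal_sum => q /Ss /SS'; exact: gen_idealM.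
Qed.

End GenIdeal.

(** * Coefficients and supports of pure difference binomials *)

Section Binomials.
Variables (K : fieldType) (n : nat).
Implicit Types u v m : 'X_{1..n}.

Lemma mcoeff_binomial u v m : (binomial K u v)@_m = (u == m)%:R - (v == m)%:R.
Proof. by rewrite mcoeffB !mcoeffX. Qed.

Lemma msupp_binomial u v m : m \in msupp (binomial K u v) -> m = u \/ m = v.
Proof.
rewrite mcoeff_msupp mcoeff_binomial; have [->|_] := eqVneq u m; first by left.
by have [->|_] := eqVneq v m; [right | rewrite subrr eqxx].
Qed.

Lemma mem_msupp_binomial u v : u != v -> u \in msupp (binomial K u v).
Proof.
by rewrite eq_sym mcoeff_msupp mcoeff_binomial eqxx => /negPf->; rewrite subr0 oner_neq0.
Qed.

Lemma binomialN u v : - binomial K u v = binomial K v u.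
Proof. by rewrite /binomial opprB. Qed.

End Binomials.

(** Dickson's lemma, by induction on the number [k] of coordinates compared. A list [s] that works
    for [k] coordinates also serves every [m] whose next coordinate is at least all those occurring
    in [s]. The other [m] fall into finitely many slices with that coordinate fixed, and induction
    applies to each slice. *)
Lemma dickson n (P : 'X_{1..n} -> Prop) :
  exists s : seq 'X_{1..n}, (forall x, x \in s -> P x)
    /\ forall m, P m -> exists2 x, x \in s & (x <= m)%MM.
Proof.
suff H k : exists s : seq 'X_{1..n}, (forall x, x \in s -> P x)
    /\ forall m, P m -> exists2 x, x \in s & forall i : 'I_n, (i < k)%N -> (x i <= m i)%N.
  have [s [sP sH]] := H n; exists s; split=> // m /sH[x sx le_xm].
  by exists x => //; apply/mnm_lepP => i; apply: le_xm.
elim: k P => [|k IHk] P.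
  have [[m Pm]|noP] := classic (exists m, P m); last first.
    by exists [::]; split=> // m Pm; case: noP; exists m.
  exists [:: m]; split=> [x|m' _]; first by rewrite inE => /eqP->.
  by exists m; rewrite ?mem_head.
have [s [sP sH]] := IHk P.
have [nk|lt_kn] := leqP n k.
  exists s; split=> // m /sH[x sx le_xm]; exists x => // i _.
  by apply: le_xm; apply: leq_trans nk.
pose i0 := Ordinal lt_kn.
have [t [tP tH]] : exists t : seq 'X_{1..n}, (forall x, x \in t -> P x) /\
    forall m, P m -> (m i0 < \max_(x <- s) x i0)%N ->
    exists2 x, x \in t & forall i : 'I_n, (i < k.+1)%N -> (x i <= m i)%N.
  elim: (\max_(x <- s) _) => [|b [t [tP tH]]]; first by exists [::].
  have [t' [t'P t'H]] := IHk (fun m => P m /\ m i0 = b).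
  exists (t' ++ t); split=> [x|m Pm].
    by rewrite mem_cat => /orP[/t'P[]|/tP].
  rewrite ltnS leq_eqVlt => /orP[/eqP mb|/(tH _ Pm)[x tx le_xm]]; last first.
    by exists x => //; rewrite mem_cat tx orbT.
  have [x tx le_xm] := t'H _ (conj Pm mb); exists x; first by rewrite mem_cat tx.
  move=> i; rewrite ltnS leq_eqVlt => /orP[/eqP ik|]; last exact: le_xm.
  have -> : i = i0 by apply: val_inj.
  by have [_ ->] := t'P _ tx; rewrite mb.
exists (s ++ t); split=> [x|m Pm]; first by rewrite mem_cat => /orP[/sP|/tP].
have [/(tH _ Pm)[x tx le_xm]|ge_m] := ltnP (m i0) (\max_(x <- s) x i0).
  by exists x => //; rewrite mem_cat tx orbT.
have [x sx le_xm] := sH _ Pm; exists x; first by rewrite mem_cat sx.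
move=> i; rewrite ltnS leq_eqVlt => /orP[/eqP ik|]; last exact: le_xm.
have -> : i = i0 by apply: val_inj.
by apply: leq_trans ge_m; rewrite (big_rem x) //= leq_maxl.
Qed.

(** * Term orders eliminating the variables outside a given set *)

Section EliminationOrder.
Variables (n : nat) (S : pred 'I_n).
Implicit Types u v m : 'X_{1..n}.

Definition elim_weight m : nat := (\sum_(i | ~~ S i) m i)%N.

Definition elim_le u v : bool :=
  (elim_weight u < elim_weight v)%N
  || (elim_weight u == elim_weight v) && (u <= v)%O.

Lemma elim_weightD u v : elim_weight (u + v)%MM = (elim_weight u + elim_weight v)%N.
Proof. by rewrite /elim_weight -big_split; apply: eq_bigr => i _; rewrite mnmDE. Qed.

Lemma elim_le_weight u v : elim_le u v -> (elim_weight u <= elim_weight v)%N.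
Proof. by case/orP=> [/ltnW//|/andP[/eqP->]]. Qed.

Lemma elim_le_term_order : term_order elim_le.
Proof.
split=> [u v|u v|v u w|u|w u v]; rewrite /elim_le.
- by case: ltngtP => //= _; apply: le_total.
- by case: ltngtP => //= _; apply: le_anti.
- case/orP=> [uv|/andP[/eqP-> uv]] /orP[vw|/andP[/eqP<- vw]].
  + by rewrite (ltn_trans uv vw).
  + by rewrite uv.
  + by rewrite vw.
  + by rewrite eqxx (le_trans uv vw) orbT.
- have -> : elim_weight 0%MM = 0%N by rewrite /elim_weight big1 // => i _; rewrite mnm0E.
  by case: (elim_weight u) => //=; rewrite le0x.
rewrite !elim_weightD ltn_add2r eqn_add2r lemc_add2l; exact: id.
Qed.

End EliminationOrder.

(** * Toric ideals of arbitrary exponent configurations and their grading *)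

Section Toric.
Variables (K : fieldType) (n p : nat) (a : 'I_n -> 'X_{1..p}).
Implicit Types (u v m : 'X_{1..n}) (f g : {mpoly K[n]}).

Definition toric f : Prop := f \mPo [tuple 'X_[a j] | j < n] = 0.

(** The multidegree: the exponent of the image of the monomial [m], that is, the matrix with columns
    [a j] applied to [m]. *)
Definition adeg m : 'X_{1..p} := (\sum_(j < n) a j *+ m j)%MM.

Lemma adegE m i : adeg m i = (\sum_(j < n) a j i * m j)%N.
Proof. by rewrite /adeg mnm_sumE; apply: eq_bigr => j _; rewrite mulmnE. Qed.

Lemma adegD u v : adeg (u + v)%MM = (adeg u + adeg v)%MM.
Proof.
apply/mnmP=> i; rewrite mnmDE !adegE -big_split.
by apply: eq_bigr => j _; rewrite mnmDE mulnDr.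
Qed.

Lemma comp_mpolyX_adeg m :
  'X_[m] \mPo [tuple 'X_[a j] | j < n] = 'X_[adeg m] :> {mpoly K[p]}.
Proof.
rewrite comp_mpolyX /adeg (big_morph _ (@mpolyXD _ _) (@mpolyX0 _ _)).
by apply: eq_bigr => j _; rewrite tnth_mktuple mpolyXn.
Qed.

Lemma toric_binomialP u v : toric (binomial K u v) <-> adeg u = adeg v.
Proof.
rewrite /toric /binomial comp_mpolyB !comp_mpolyX_adeg; split=> [|->]; last exact: subrr.
move/(congr1 (mcoeff (adeg u)))/eqP; rewrite mcoeffB !mcoeffX eqxx mcoeff0.
by have [->|_] := eqVneq (adeg v) (adeg u); rewrite ?subr0 ?oner_eq0.
Qed.

(** The sum is the coefficient of ['X_[d]] in the image of [f]. *)
Lemma toric_fiber_sum f d : toric f -> \sum_(m <- msupp f | adeg m == d) f@_m = 0.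
Proof.
rewrite /toric {1}(mpolyE f) raddf_sum /= => /(congr1 (mcoeff d)).
rewrite raddf_sum mcoeff0 /= => {2}<-; rewrite big_mkcond; apply: eq_bigr => m _.
by rewrite comp_mpolyZ comp_mpolyX_adeg mcoeffZ mcoeffX; case: eqP; rewrite ?mulr1 ?mulr0.
Qed.

Hypothesis a_neq0 : forall j, a j != 0%MM.

(** Every variable maps to a nonconstant monomial. This makes the fibers of [adeg] finite and the
    grading by [adeg_weight] positive. *)
Lemma adeg_ge m : (mdeg m <= mdeg (adeg m))%N.
Proof.
rewrite /adeg mdeg_sum mdegE; apply: leq_sum => j _.
by rewrite mdegMn leq_pmull // lt0n mdeg_eq0.
Qed.

Definition adeg_weight m : nat := mdeg (adeg m).

Lemma adeg_weightD u v : adeg_weight (u + v)%MM = (adeg_weight u + adeg_weight v)%N.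
Proof. by rewrite /adeg_weight adegD mdegD. Qed.

(** Projection onto the components of weight below [d]. The bound on the total degree only makes the
    sum finite: by [adeg_ge] no monomial of weight below [d] is lost. *)
Definition trunc d f : {mpoly K[n]} :=
  \sum_(m : 'X_{1..n < d} | (adeg_weight m < d)%N) f@_m *: 'X_[m].

Lemma truncD d : {morph trunc d : f g / f + g}.
Proof.
by move=> f g; rewrite /trunc -big_split; apply: eq_bigr => m _; rewrite mcoeffD scalerDl.
Qed.

Lemma truncZ d c f : trunc d (c *: f) = c *: trunc d f.
Proof.
by rewrite /trunc scaler_sumr; apply: eq_bigr => m _; rewrite mcoeffZ scalerA.
Qed.

Lemma trunc0 d : trunc d 0 = 0.
Proof. by have := truncZ d 0 0; rewrite !scale0r. Qed.

Lemma trunc_sum d (I : Type) (s : seq I) (F : I -> {mpoly K[n]}) :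
  trunc d (\sum_(i <- s) F i) = \sum_(i <- s) trunc d (F i).
Proof. exact: (big_morph _ (truncD d) (trunc0 d)). Qed.

Lemma truncX d m : trunc d 'X_[m] = if (adeg_weight m < d)%N then 'X_[m] else 0.
Proof.
rewrite /trunc; case: ifP => [lt_m|nlt_m].
  have lt_md : (mdeg m < d)%N by apply: leq_ltn_trans lt_m; apply: adeg_ge.
  rewrite (bigD1 (BMultinom lt_md)) //= big1 => [|m' /andP[_ /negPf ne]].
    by rewrite mcoeffX eqxx scale1r addr0.
  have -> : ('X_[m] : {mpoly K[n]})@_m' = 0.
    rewrite mcoeffX; case: eqP => // em.
    by move: ne; rewrite -val_eqE /= em eqxx.
  by rewrite scale0r.
apply: big1 => m' lt_m'; rewrite mcoeffX; case: eqP => [em|_]; last by rewrite scale0r.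
by rewrite em lt_m' in nlt_m.
Qed.

(** Both terms have the same weight, so truncation keeps or kills the product as a whole. *)
Lemma trunc_monomial_binomial d m u v : adeg u = adeg v ->
  trunc d ('X_[m] * binomial K u v)
    = if (adeg_weight (m + u)%MM < d)%N then 'X_[m] * binomial K u v else 0.
Proof.
move=> euv; have ew : adeg_weight (m + u)%MM = adeg_weight (m + v)%MM.
  by rewrite /adeg_weight !adegD euv.
rewrite /binomial mulrBr -!mpolyXD -scaleN1r truncD truncZ !truncX -ew.
by case: ifP; rewrite ?scaler0 ?addr0 // scaleN1r.
Qed.

Lemma trunc_id d f :
  (forall m, m \in msupp f -> (adeg_weight m < d)%N) -> trunc d f = f.
Proof.
move=> ltd; rewrite [RHS](mpolyE f) {1}(mpolyE f) trunc_sum big_seq [RHS]big_seq.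
by apply: eq_bigr => m /ltd lt_m; rewrite truncZ truncX lt_m.
Qed.

(* Truncating an expression of [h] in terms of [B] at the weight of [f] kills
   the multiples of [f] and leaves [h] unchanged. *)
Lemma gen_ideal_lower_weight (B : {mpoly K[n]} -> Prop) u v h :
  (forall f, B f -> exists u v, u != v /\ f = binomial K u v) ->
  generates B toric -> u != v -> adeg u = adeg v ->
  toric h -> (forall m, m \in msupp h -> (adeg_weight m < adeg_weight u)%N) ->
  gen_ideal (fun g => B g /\ g <> binomial K u v) h.
Proof.
move=> Bbin Bgen neuv euv /Bgen[s [Bs eh]] lt_h.
rewrite -(trunc_id lt_h) eh trunc_sum; apply: gen_ideal_sum => -[q b] /Bs /= Bb.
rewrite {1}(mpolyE q) mulr_suml trunc_sum; apply: gen_ideal_sum => m _.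
rewrite -scalerAl truncZ -mul_mpolyC; apply: gen_idealM.
have [u' [v' [neuv' eb]]] := Bbin _ Bb.
have euv' : adeg u' = adeg v'.
  by apply/toric_binomialP; rewrite -eb; apply/Bgen/gen_ideal_mem.
rewrite eb trunc_monomial_binomial //; case: ifP => [lt_mu'|_]; last exact: gen_ideal0.
apply/gen_idealM/gen_ideal_mem; rewrite -eb; split=> // ebf; move: lt_mu'.
have wuv : adeg_weight u = adeg_weight v by rewrite /adeg_weight euv.
have: u' \in msupp (binomial K u v) by rewrite -ebf eb mem_msupp_binomial.
by case/msupp_binomial=> ->; rewrite adeg_weightD ltnNge wuv leq_addl.
Qed.

Lemma binomial_common_variable u v i : (0 < u i)%N -> (0 < v i)%N ->
  binomial K u v = 'X_[U_(i)] * binomial K (u - U_(i)) (v - U_(i)).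
Proof.
move=> ui vi; rewrite /binomial mulrBr -!mpolyXD ![(U_(i) + _)%MM]addmC !submK //.
  by apply/mnm_lepP=> j; rewrite mnm1E; case: eqP => // <-.
by apply/mnm_lepP=> j; rewrite mnm1E; case: eqP => // <-.
Qed.

Lemma not_markov u v m i j :
  u != v -> adeg u = adeg m -> adeg m = adeg v ->
  (0 < u i)%N -> (0 < m i)%N -> (0 < m j)%N -> (0 < v j)%N ->
  ~ universal_markov_basis toric (binomial K u v).
Proof.
move=> neuv eum emv ui mi mj vj [B [Bbin Bgen Bmin] Bf].
pose B' g := B g /\ g <> binomial K u v.
suff /Bmin H : generates B' toric by case: (H _ _ Bf) => [g []|].
have lower (w w' : 'X_{1..n}) k : (0 < w k)%N -> (0 < w' k)%N ->
    adeg w = adeg w' -> adeg w = adeg u -> gen_ideal B' (binomial K w w').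
  move=> wk w'k eww' ewu; rewrite (binomial_common_variable wk w'k).
  have subK (x : 'X_{1..n}) : (0 < x k)%N -> (x - U_(k) + U_(k))%MM = x.
    by move=> xk; apply/submK/mnm_lepP=> l; rewrite mnm1E; case: eqP => // <-.
  have ltx (x : 'X_{1..n}) : (0 < x k)%N -> adeg x = adeg u ->
      (adeg_weight (x - U_(k))%MM < adeg_weight u)%N.
    move=> xk exu; rewrite [ltnRHS](_ : _ = adeg_weight x); last by rewrite /adeg_weight exu.
    rewrite -[in ltnRHS](subK x xk) adeg_weightD -addn1 leq_add2l.
    by apply: leq_trans (adeg_ge _); rewrite mdeg1.
  apply/gen_idealM/gen_ideal_lower_weight => //.
  - by rewrite eum.
  - apply/toric_binomialP/(@addIm _ (adeg U_(k)%MM)).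
    by rewrite -!adegD !subK.
  by move=> x /msupp_binomial[->|->]; apply: ltx; rewrite -?eww'.
move=> g; split=> [Bg|/Bgen].
  by apply/Bgen; apply: gen_ideal_trans Bg => h [Bh _]; apply: gen_ideal_mem.
apply: gen_ideal_trans => h Bh; have [->|/eqP neh] := eqVneq h (binomial K u v); last first.
  exact: gen_ideal_mem.
have -> : binomial K u v = binomial K u m + binomial K m v by rewrite /binomial addrA subrK.
by apply: gen_idealD; [apply: (lower _ _ i) | apply: (lower _ _ j)].
Qed.

(** * Normal forms and the reduced Groebner basis of a toric ideal *)

Section NormalForm.
Variables (le : rel 'X_{1..n}) (le_order : term_order le).

Definition fiber m : seq 'X_{1..n} :=
  [seq bmnm x | x <- enum {: 'X_{1..n < (adeg_weight m).+1}} & adeg (bmnm x) == adeg m].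

Lemma mem_fiber m x : (x \in fiber m) = (adeg x == adeg m).
Proof.
apply/mapP/eqP => [[y]|ex]; first by rewrite mem_filter => /andP[/eqP ? _] ->.
have ltx : (mdeg x < (adeg_weight m).+1)%N by rewrite ltnS /adeg_weight -ex adeg_ge.
by exists (BMultinom ltx) => //; rewrite mem_filter /= ex eqxx mem_enum.
Qed.

(** The smallest monomial of the fiber. The default [m] of [head] is never reached, since the fiber
    contains [m]. *)
Definition normal_form m : 'X_{1..n} := head m (sort le (fiber m)).

Lemma normal_form_spec m :
  adeg (normal_form m) = adeg m /\ forall x, adeg x = adeg m -> le (normal_form m) x.
Proof.
have [le_total _ le_trans _ _] := le_order; rewrite /normal_form.
have mem x : (x \in sort le (fiber m)) = (adeg x == adeg m) by rewrite mem_sort mem_fiber.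
move: (sort_sorted le_total (fiber m)) mem.
case: (sort le (fiber m)) => [|y s] /=; first by move=> _ /(_ m); rewrite eqxx.
move=> /(order_path_min le_trans)/allP min_y mem; split=> [|x /eqP].
  by apply/eqP; rewrite -mem mem_head.
rewrite -mem inE => /orP[/eqP->|/min_y//].
by case/orP: (le_total y y).
Qed.

Lemma adeg_normal_form m : adeg (normal_form m) = adeg m.
Proof. by case: (normal_form_spec m). Qed.

Lemma normal_form_le m x : adeg x = adeg m -> le (normal_form m) x.
Proof. by case: (normal_form_spec m) => _; apply. Qed.

Lemma normal_form_min m x : adeg x = adeg m -> le x (normal_form m) -> x = normal_form m.
Proof.
have [_ le_anti _ _ _] := le_order.
by move=> ex le_x; apply: le_anti; rewrite le_x normal_form_le.
Qed.

Definition standard m : bool := normal_form m == m.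

Lemma standard_normal_form m : standard (normal_form m).
Proof.
apply/eqP/normal_form_min; first by rewrite !adeg_normal_form.
by apply: normal_form_le; rewrite adeg_normal_form.
Qed.

(** Translating [normal_form m] by [m' - m] gives a monomial in the fiber of [m'] that is not above
    [m'], hence equals it; then cancel the translation. *)
Lemma standard_dvd m m' : (m <= m')%MM -> standard m' -> standard m.
Proof.
move=> le_mm' /eqP st; have [_ _ _ _ le_add] := le_order.
have := le_add (m' - m)%MM _ _ (normal_form_le (erefl (adeg m))).
rewrite [(m + _)%MM]addmC submK // -{2}st => /normal_form_min.
rewrite st adegD adeg_normal_form -adegD [(m + _)%MM]addmC submK // => /(_ erefl) e.
by apply/eqP/(@addmI _ (m' - m)%MM); rewrite submK // addmC.
Qed.

(** If [m] were smallest in its fiber, then, being the leading monomial, it would be the only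
    monomial of [f] there, and the fiber sum would be its nonzero coefficient. *)
Lemma lead_nonstandard f m : toric f -> is_lead le f m -> ~~ standard m.
Proof.
move=> If [m_f lead_m]; apply/negP => /eqP st.
have: f@_m != 0 by rewrite -mcoeff_msupp.
move: (toric_fiber_sum (adeg m) If).
rewrite big_mkcond (bigD1_seq m) ?msupp_uniq //= eqxx big1_seq ?addr0 => [->|].
  by rewrite eqxx.
move=> m' /andP[ne_m' /lead_m le_m'm]; case: eqP => // em'.
by rewrite -st in le_m'm; rewrite (normal_form_min em' le_m'm) st eqxx in ne_m'.
Qed.

Lemma lead_binomial_normal_form m :
  ~~ standard m -> is_lead le (binomial K m (normal_form m)) m.
Proof.
rewrite /standard eq_sym => nst; split; first exact: mem_msupp_binomial.
by move=> m' /msupp_binomial[]->; last apply: normal_form_le;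
   have [tot _ _ _ _] := le_order; case/orP: (tot m m).
Qed.

Lemma is_lead_uniq f m m' : is_lead le f m -> is_lead le f m' -> m = m'.
Proof.
have [_ le_anti _ _ _] := le_order => -[mf mle] [m'f m'le].
by apply: le_anti; rewrite mle // m'le.
Qed.

(** These are the minimal monomial generators of the initial ideal. *)
Definition minimal_nonstandard m : Prop :=
  ~~ standard m /\ forall m', (m' <= m)%MM -> ~~ standard m' -> m' = m.

Lemma minimal_nonstandard_exists m :
  ~~ standard m -> exists2 m', (m' <= m)%MM & minimal_nonstandard m'.
Proof.
elim: {m}(mdeg m).+1 {-2}m (ltnSn (mdeg m)) => // d IHd m; rewrite ltnS => le_md nst.
have [min_m|nmin] := classic (forall m', (m' <= m)%MM -> ~~ standard m' -> m' = m).
  by exists m; first exact: lepm_refl.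
have [m' nmin'] := not_all_ex_not _ _ nmin.
have [le_m' nmin''] := imply_to_and _ _ nmin'.
have [nst' ne_m'] := imply_to_and _ _ nmin''.
have lt_m' : (mdeg m' < mdeg m)%N.
  rewrite -[in ltnRHS](submK le_m') mdegD -{1}[mdeg m']add0n ltn_add2r lt0n mdeg_eq0.
  by apply/eqP => e; apply: ne_m'; rewrite -[RHS](submK le_m') e add0m.
have [m1 le_m1 min_m1] := IHd m' (leq_trans lt_m' le_md) nst'.
by exists m1 => //; apply: lepm_trans le_m'.
Qed.

(** The basis consists of the differences of the minimal generators of the initial ideal and their
    normal forms; Dickson's lemma makes it finite. *)
Lemma reduced_groebner_basis_toric :
  exists2 G, reduced_groebner_basis le toric G
    & forall m, minimal_nonstandard m -> binomial K m (normal_form m) \in G.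
Proof.
(* An element of [s] below a minimal nonstandard monomial equals it, so [s] lists all of them. *)
have [s [s_min min_s]] := dickson minimal_nonstandard.
have sP m : minimal_nonstandard m -> m \in s.
  move=> min_m; have [x sx le_x] := min_s _ min_m.
  by rewrite -(min_m.2 x le_x) //; case: (s_min x sx).
exists [seq binomial K m (normal_form m) | m <- s]; last by move=> m /sP; apply: map_f.
have toricG g : g \in [seq binomial K m (normal_form m) | m <- s] -> toric g.
  by case/mapP=> m _ ->; apply/toric_binomialP; rewrite adeg_normal_form.
split; first split=> // f; first split.
- apply: gen_ideal_trans => _ [g [m [Ig lead_m ->]]].
  have [m' le_m' min_m'] := minimal_nonstandard_exists (lead_nonstandard Ig lead_m).
  rewrite -(submK le_m') mpolyXD; apply/gen_idealM/gen_ideal_mem.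
  exists (binomial K m' (normal_form m')), m'; split=> //; first exact/map_f/sP.
  by apply: lead_binomial_normal_form; case: min_m'.
- apply: gen_ideal_trans => _ [g [m [/toricG Ig lead_m ->]]].
  by apply: gen_ideal_mem; exists g, m.
- move=> _ /mapP[m /s_min[nst _] ->]; exists m; first exact: lead_binomial_normal_form.
  by rewrite mcoeff_binomial eqxx -/(standard m) (negPf nst) subr0.
move=> _ _ m m' /mapP[m0 sm0 ->] /mapP[m1 sm1 ->] ne_gh lead_m m'h.
have [nst0 _] := s_min _ sm0.
rewrite (is_lead_uniq lead_m (lead_binomial_normal_form nst0)); apply/negP => le_m0.
(* Dividing the leading monomial of the other element contradicts its minimality; dividing the
   trailing one is impossible, as that one is standard. *)
case/msupp_binomial: m'h => em'; rewrite em' in le_m0.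
  by move: ne_gh; rewrite (proj2 (s_min _ sm1) m0) ?eqxx.
by move: nst0; rewrite (standard_dvd le_m0) ?standard_normal_form.
Qed.

End NormalForm.

(** * Circuits and their membership in the Graver and universal Groebner bases *)

(** The last clause encodes minimal support and coprime entries at once: the integral kernel vectors
    supported inside the support of [u - v] are its integer multiples. *)
Definition circuit u v : Prop :=
  [/\ u != v, adeg u = adeg v, forall i, u i = 0%N \/ v i = 0%N
    & forall u' v', adeg u' = adeg v' ->
        (forall i, u i = 0%N -> v i = 0%N -> u' i = v' i) ->
        exists k : int, forall i, (u' i)%:Z - (v' i)%:Z = k * ((u i)%:Z - (v i)%:Z)].

Lemma circuitC u v : circuit u v -> circuit v u.
Proof.
case=> neuv euv disj circ; split=> [||i|u' v' e' supp]; rewrite 1?eq_sym //.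
  by case: (disj i); [right|left].
have [|k Hk] := circ u' v' e'; first by move=> i ui vi; apply: supp.
by exists (- k) => i; rewrite Hk mulNr -mulrN opprB.
Qed.

Lemma circuit_neq0 u v : circuit u v -> exists i, (0 < u i)%N.
Proof.
case=> neuv euv _ _; apply/existsP/contraT; rewrite negb_exists => /forallP u0.
have e0 : u = 0%MM by apply/mnmP=> i; rewrite mnm0E; apply/eqP; rewrite -leqn0 leqNgt u0.
have: (mdeg v <= mdeg (adeg u))%N by rewrite euv adeg_ge.
have -> : adeg u = 0%MM.
  rewrite e0; apply/mnmP=> i; rewrite adegE big1 ?mnm0E // => j _.
  by rewrite mnm0E muln0.
by rewrite mdeg0 leqn0 mdeg_eq0 -e0 eq_sym (negPf neuv).
Qed.

(** Write [u' - v'] as [k] times [u - v]. A coordinate where [v] is positive has [u' = 0], which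
    gives [k >= 0]; and [k] is nonzero, so [u' >= u] and [v' >= v]. *)
Lemma circuit_multiple u v u' v' : circuit u v -> adeg u' = adeg v' -> u' != v' ->
  (u' <= u)%MM -> (forall i, u i = 0%N -> v i = 0%N -> u' i = v' i) ->
  u' = u /\ (v <= v')%MM.
Proof.
move=> circ e' ne' /mnm_lepP le_u' supp; have [_ _ disj gen] := circ.
have [k Hk] := gen _ _ e' supp.
have [i ui] := circuit_neq0 circ; have [j vj] := circuit_neq0 (circuitC circ).
have k_ge0 : 0 <= k.
  have uj : u j = 0%N by case: (disj j) => // vj0; rewrite vj0 in vj.
  have := Hk j; have := le_u' j; rewrite uj leqn0 => /eqP-> ; nia.
have vi : v i = 0%N by case: (disj i) => // ui0; rewrite ui0 in ui.
have k_neq0 : k != 0.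
  apply: contra ne' => /eqP k0; apply/eqP/mnmP => l; have := Hk l; rewrite k0; lia.
have k1 l : (u l <= u' l)%N.
  have := Hk l; case: (disj l) => dl; rewrite dl; nia.
have eu : u' = u by apply/mnmP => l; apply/eqP; rewrite eqn_leq le_u' k1.
split=> //; apply/mnm_lepP => l; have := Hk l; rewrite eu.
case: (disj l) => dl; rewrite dl ?leq0n //; nia.
Qed.

Lemma circuit_graver u v : circuit u v -> graver_basis toric (binomial K u v).
Proof.
move=> circ; have [neuv euv disj _] := circ.
exists u, v; split=> //; split=> // [|u' v' ne' /toric_binomialP e' le_u' le_v'].
  exact/toric_binomialP.
have [|->  le_v] := circuit_multiple circ e' ne' le_u'.
  move=> i ui vi; move/mnm_lepP/(_ i): le_u'; move/mnm_lepP/(_ i): le_v'.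
  by rewrite ui vi !leqn0 => /eqP-> /eqP->.
congr pair; apply/mnmP=> i; apply/eqP; rewrite eqn_leq.
by move/mnm_lepP/(_ i): le_v' => ->; move/mnm_lepP/(_ i): le_v.
Qed.

(* For an elimination order of the variables outside the circuit, every monomial
   dividing [u] reduces inside the circuit, hence only [u] itself reduces. *)
Lemma circuit_reduced_groebner u v S : circuit u v ->
  (forall i, S i = (0 < u i)%N || (0 < v i)%N) -> elim_le S v u ->
  universal_groebner_basis toric (binomial K u v).
Proof.
move=> circ SE le_vu; have [neuv euv _ _] := circ.
have le_order := elim_le_term_order S; have [_ le_anti _ _ _] := le_order.
have [G Gred Gmin] := reduced_groebner_basis_toric le_order.
exists (elim_le S), G; split=> //.
have reduce m : (m <= u)%MM -> ~~ standard (elim_le S) m ->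
    m = u /\ (v <= normal_form (elim_le S) m)%MM.
  move=> le_mu; rewrite /standard eq_sym => nst.
  apply: (circuit_multiple circ) => //; first by rewrite adeg_normal_form.
  have off_m i : ~~ S i -> m i = 0%N.
    rewrite SE negb_or -leqNgt leqn0 => /andP[/eqP ui _].
    by apply/eqP; rewrite -leqn0 -ui; move/mnm_lepP: le_mu; apply.
  have := elim_le_weight (normal_form_le le_order (erefl (adeg m))).
  rewrite [X in (_ <= X)%N]big1 // leqn0 sum_nat_eq0 => /forall_inP off_nf i ui vi.
  have nSi : ~~ S i by rewrite SE ui vi.
  by rewrite off_m // (eqP (off_nf i nSi)).
have nst_u : ~~ standard (elim_le S) u.
  apply: contra neuv => /eqP st; apply/eqP/le_anti; rewrite le_vu andbT -{1}st.
  exact: normal_form_le.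
have min_u : minimal_nonstandard (elim_le S) u by split=> // m le_mu /(reduce _ le_mu)[].
have [_ le_v] := reduce _ (lepm_refl u) nst_u.
suff e : normal_form (elim_le S) u = v by rewrite -[X in binomial _ _ X]e; apply: Gmin.
(* The normal form of [u] and its divisor [v] have the same multidegree, so their quotient has
   multidegree zero and is trivial. *)
have := adegD (normal_form (elim_le S) u - v)%MM v.
rewrite submK // adeg_normal_form // euv => /(congr1 mdeg)/eqP.
rewrite mdegD -{1}[mdeg _]add0n eqn_add2r eq_sym => /eqP d0.
rewrite -[LHS](submK le_v); suff -> : (normal_form (elim_le S) u - v = 0)%MM by rewrite add0m.
by apply/eqP; rewrite -mdeg_eq0 -leqn0 -d0 adeg_ge.
Qed.

(** The sign is decided by which of the two monomials is larger in the elimination order. *)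
Lemma circuit_universal_groebner u v : circuit u v ->
  universal_groebner_basis toric (binomial K u v)
  \/ universal_groebner_basis toric (- binomial K u v).
Proof.
move=> circ; pose S i := (0 < u i)%N || (0 < v i)%N.
have [le_tot _ _ _ _] := elim_le_term_order S; rewrite binomialN.
case/orP: (le_tot v u) => le_uv; [left | right].
  exact: (circuit_reduced_groebner (S := S)).
apply: (circuit_reduced_groebner (S := S)) => //; first exact: circuitC.
by move=> i; rewrite /S orbC.
Qed.

Lemma circuit_universal_markov u v :
  same_up_to_sign (universal_groebner_basis toric) (universal_markov_basis toric)
  \/ same_up_to_sign (graver_basis toric) (universal_markov_basis toric) ->
  circuit u v ->
  universal_markov_basis toric (binomial K u v)
  \/ universal_markov_basis toric (binomial K v u).
Proof.
rewrite -(binomialN _ u v) => -[] same circ; apply: (proj1 (same _)).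
  exact: circuit_universal_groebner.
by left; apply: circuit_graver.
Qed.

End Toric.

(** * From the toric ideal of a graph to integral kernel vectors of its incidence matrix *)

Section Bridge.
Variables (K : fieldType) (T : finType) (D : wograph T).
Implicit Types (x : T) (f : T * T) (y z h : T * T -> int).

(** Edge vectors are functions on all pairs, so that vectors on [D] and on its subgraphs have one
    type; only the values on edges matter. *)
Definition in_kernel y : Prop := forall x, x \in vertices D ->
  \sum_(f in edges D) (incidence_entry D x f)%:Z * y f = 0.

Lemma in_kernelN y : in_kernel y -> in_kernel (fun f => - y f).
Proof.
move=> yK x /yK; under [in X in _ -> X]eq_bigr => f _ do rewrite mulrN.
by rewrite sumrN => ->; rewrite oppr0.
Qed.

Lemma in_kernel_comb y z (c d : int) :
  in_kernel y -> in_kernel z -> in_kernel (fun f => c * y f + d * z f).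
Proof.
move=> yK zK x xD.
under eq_bigr => f _ do rewrite mulrDr [_ * (c * _)]mulrCA [_ * (d * _)]mulrCA.
by rewrite big_split /= -!mulr_sumr yK // zK // !mulr0 addr0.
Qed.

(** The exponent of the image of an edge variable, which is a column of the incidence matrix. *)
Definition edge_degree (j : 'I_#|edges D|) : 'X_{1..#|vertices D|} :=
  (U_(tail_index j) + U_(head_index j) *+ weight D (enum_val j).2)%MM.

Lemma edge_degreeE j i :
  edge_degree j i = incidence_entry D (enum_val i) (enum_val j).
Proof.
rewrite /edge_degree mnmDE mulmnE !mnm1E /incidence_entry.
rewrite -!(inj_eq enum_val_inj) !enum_rankK_in ?tail_in ?head_in //.
rewrite ![_ == enum_val i]eq_sym; case: eqP => [e1|_]; case: eqP => [e2|_] //=.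
- by have := loopless D (enum_val i); rewrite {1}e1 e2 -surjective_pairing enum_valP.
- by rewrite e2 mul1n.
Qed.

Lemma edge_degree_neq0 j : edge_degree j != 0%MM.
Proof.
apply/eqP => /mnmP/(_ (tail_index j)); rewrite mnm0E edge_degreeE.
by rewrite /incidence_entry enum_rankK_in ?tail_in // eqxx.
Qed.

Lemma toric_idealE : @toric_ideal K T D = toric edge_degree.
Proof.
suff -> : toric edge_degree = fun f : {mpoly K[#|edges D|]} =>
  f \mPo [tuple 'X_[edge_degree j] | j < #|edges D|] = 0.
  congr (fun t (f : {mpoly K[#|edges D|]}) => f \mPo t = 0).
  by apply: eq_mktuple => j; rewrite /edge_image mpolyXD mpolyXn.
by [].
Qed.

Lemma adeg_eqP (u v : 'X_{1..#|edges D|}) y :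
  (forall j, (u j)%:Z - (v j)%:Z = y (enum_val j)) ->
  adeg edge_degree u = adeg edge_degree v <-> in_kernel y.
Proof.
move=> uvy; have key i : (adeg edge_degree u i)%:Z - (adeg edge_degree v i)%:Z
    = \sum_(f in edges D) (incidence_entry D (enum_val i) f)%:Z * y f.
  rewrite !adegE -!natz !natr_sum -sumrB [RHS]big_enum_val; apply: eq_bigr => j _.
  by rewrite -uvy mulrBr edge_degreeE !natz !PoszM.
split=> [e x xD|yK].
  by have := key (enum_rank_in xD x); rewrite enum_rankK_in // => <-; rewrite e subrr.
apply/mnmP=> i; apply/eqP; rewrite -eqz_nat -subr_eq0 key yK //; exact: enum_valP.
Qed.

Definition positive_part y : 'X_{1..#|edges D|} :=
  [multinom if (0 <= y (enum_val j))%R then `|y (enum_val j)|%N else 0%N | j < #|edges D|].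

Lemma positive_part_sub y j :
  (positive_part y j)%:Z - (positive_part (fun f => - y f) j)%:Z = y (enum_val j).
Proof. by rewrite !mnmE /=; do 2!case: ifP; lia. Qed.

Lemma circuit_of_kernel z f0 :
  in_kernel z -> f0 \in edges D -> z f0 != 0 ->
  (forall y, in_kernel y -> (forall f, f \in edges D -> z f = 0 -> y f = 0) ->
     exists k, forall f, f \in edges D -> y f = k * z f) ->
  circuit edge_degree (positive_part z) (positive_part (fun f => - z f)).
Proof.
move=> zK Df0 zf0 zgen; split.
- apply: contra zf0 => /eqP e.
  have := positive_part_sub z (enum_rank_in Df0 f0).
  by rewrite e subrr enum_rankK_in // => <-.
- exact/(adeg_eqP (positive_part_sub z)).
- move=> j; rewrite !mnmE /=; do 2!case: ifP; lia.
move=> u' v' e' off.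
(* The sum has at most one term: it moves a vector indexed by ordinals to a function on pairs, with
   value 0 off the edges. *)
pose y f := \sum_(j | enum_val j == f) ((u' j)%:Z - (v' j)%:Z).
have yE j : y (enum_val j) = (u' j)%:Z - (v' j)%:Z.
  by rewrite /y (big_pred1 j) // => j'; rewrite /= (inj_eq enum_val_inj).
have [| |k Hk] := zgen y.
- by apply/(@adeg_eqP u' v').
- move=> f Df; rewrite -(enum_rankK_in Df Df) => zf0'.
  by rewrite yE off ?subrr // !mnmE zf0'.
by exists k => j; rewrite -yE positive_part_sub Hk // enum_valP.
Qed.

(** With [u] and [v] the positive and negative parts of [z], the middle monomial is [m = v + h]. The
    conditions on [h] make it nonnegative: on the support of [z] it agrees with [v] or [u],
    elsewhere it is [h]. It shares the variable [f1] with [u] and [f2] with [v], so [not_markov]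
    excludes both signs of the circuit binomial. *)
Lemma robust_no_splitting z h f1 f2 :
  generalized_robust K D \/ weakly_robust K D ->
  in_kernel z -> in_kernel h ->
  (forall y, in_kernel y -> (forall f, f \in edges D -> z f = 0 -> y f = 0) ->
     exists k, forall f, f \in edges D -> y f = k * z f) ->
  (forall f, f \in edges D -> z f = 0 -> 0 <= h f) ->
  (forall f, f \in edges D -> z f != 0 -> h f = 0 \/ h f = z f) ->
  f1 \in edges D -> h f1 = z f1 -> 0 < z f1 ->
  f2 \in edges D -> h f2 = 0 -> z f2 < 0 -> False.
Proof.
move=> robust zK hK zgen h_ge0 hz Df1 hf1 zf1 Df2 hf2 zf2.
have circ : circuit edge_degree (positive_part z) (positive_part (fun f => - z f)).
  by apply: (circuit_of_kernel (f0 := f1)) => //; rewrite gt_eqF.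
set u := positive_part z in circ; set v := positive_part _ in circ.
pose m : 'X_{1..#|edges D|} := [multinom `|((v j)%:Z + h (enum_val j))%R|%N | j < #|edges D|].
have mE j : (m j)%:Z = (v j)%:Z + h (enum_val j).
  rewrite mnmE; have Ej := enum_valP j.
  have := h_ge0 _ Ej; have := hz _ Ej.
  by rewrite /v mnmE /=; case: ifP; lia.
have emv : adeg edge_degree m = adeg edge_degree v.
  by apply/(adeg_eqP (y := h)) => // j; rewrite mE addrAC subrr add0r.
have [neuv euv _ _] := circ.
have um : (0 < u (enum_rank_in Df1 f1))%N /\ (0 < m (enum_rank_in Df1 f1))%N.
  by rewrite -[(0 < m _)%N]ltz_nat mE !mnmE /= enum_rankK_in // hf1; do 2!case: ifP; lia.
have vm : (0 < v (enum_rank_in Df2 f2))%N /\ (0 < m (enum_rank_in Df2 f2))%N.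
  by rewrite -[(0 < m _)%N]ltz_nat mE !mnmE /= enum_rankK_in // hf2; case: ifP; lia.
case: um vm => [uf1 mf1] [vf2 mf2].
have := circuit_universal_markov (K := K) edge_degree_neq0 _ circ.
rewrite -toric_idealE => /(_ robust); rewrite toric_idealE.
case.
  by apply: (not_markov edge_degree_neq0 neuv _ emv uf1 mf1 mf2 vf2); rewrite emv.
by apply: (not_markov edge_degree_neq0 _ _ _ vf2 mf2 mf1 uf1); rewrite ?emv // eq_sym.
Qed.

End Bridge.

(** * Gluing kernel vectors along an edge *)

Section Core.
Variables (K : fieldType) (T : finType) (D : wograph T).
Hypothesis robust : generalized_robust K D \/ weakly_robust K D.
Implicit Types (x : T) (f : T * T) (y z h : T * T -> int).

Lemma incidence_entry_neq0 x f : x \in vertices D ->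
  (incidence_entry D x f != 0%N) = (x == f.1) || (x == f.2).
Proof.
move=> xD; rewrite /incidence_entry; have [//|_] := eqVneq x f.1.
by have [_|//] := eqVneq x f.2; rewrite -lt0n weight_gt0.
Qed.

(** An edge with both ends on [e] would be [e] itself, a loop, or antiparallel to [e]. *)
Lemma endpoint_off_edge e f : e \in edges D -> f \in edges D -> f != e ->
  exists x, [/\ x \in vertices D, x != e.1, x != e.2 & incidence_entry D x f != 0%N].
Proof.
move=> De Df ne; have /andP[Df1 Df2] := edge_ends Df.
have [f1e|f1e] := boolP ((f.1 != e.1) && (f.1 != e.2)).
  by case/andP: f1e => *; exists f.1; rewrite incidence_entry_neq0 ?eqxx.
have [f2e|f2e] := boolP ((f.2 != e.1) && (f.2 != e.2)).
  by case/andP: f2e => *; exists f.2; rewrite incidence_entry_neq0 ?eqxx ?orbT.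
case: e f De Df ne Df1 Df2 f1e f2e => [a b] [c d] /= De Df ne _ _.
rewrite !negb_and !negbK => /orP[]/eqP ec /orP[]/eqP ed; subst c d.
- by rewrite (negPf (loopless D a)) in Df.
- by rewrite eqxx in ne.
- by rewrite (negPf (no_antiparallel De)) in Df.
- by rewrite (negPf (loopless D b)) in Df.
Qed.

(** Suppose [h <= 0] off [e]. Any other edge has an end not on [e]; there all terms of the balance
    equation have one sign, so [h] vanishes on that edge. Balance at the tail of [e] then gives
    [h e = 0]. *)
Lemma kernel_positive_off_edge e h : e \in edges D -> in_kernel D h -> h e != 0 ->
  exists f, [/\ f \in edges D, f != e & 0 < h f].
Proof.
move=> De hK he; apply: NNPP => nopos.
have npos f : f \in edges D -> f != e -> h f <= 0.
  by move=> Df ne; rewrite leNgt; apply/negP => pos; apply: nopos; exists f.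
have zero f : f \in edges D -> f != e -> h f = 0.
  move=> Df ne; have [x [xD x1 x2 xf]] := endpoint_off_edge De Df ne.
  have /eqP := hK x xD; rewrite -oppr_eq0 -sumrN psumr_eq0 => [/allP/(_ f)|g Dg].
    by rewrite mem_index_enum Df oppr_eq0 mulf_eq0 => /(_ isT) /orP[]/eqP //; lia.
  have [->|neg] := eqVneq g e; last by rewrite -mulrN mulr_ge0 // oppr_ge0 npos.
  by rewrite /incidence_entry (negPf x1) (negPf x2) mul0r oppr0.
have /andP[De1 _] := edge_ends De.
have := hK _ De1; rewrite (bigD1 e) //= big1 => [|f /andP[Df ne]]; last by rewrite zero // mulr0.
by rewrite /incidence_entry eqxx mul1r addr0 => /eqP; rewrite (negPf he).
Qed.

(* [h] is the part of [z] on one side of the edge [e], balanced along [e]. *)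
Lemma no_split_circuit e z h : e \in edges D -> in_kernel D z -> in_kernel D h ->
  z e = 0 -> 0 < h e ->
  (forall f, f \in edges D -> f != e -> h f = 0 \/ h f = z f) ->
  ~ (forall y, in_kernel D y -> (forall f, f \in edges D -> z f = 0 -> y f = 0) ->
     exists k, forall f, f \in edges D -> y f = k * z f).
Proof.
move=> De zK hK ze he hz zgen.
have [|f1 [Df1 ne1 hf1]] := kernel_positive_off_edge De hK; first by rewrite gt_eqF.
(* A positive entry of [h - z] off [e] can only occur where [h] vanishes, and there [z] is
   negative. *)
have [|f2 [Df2 ne2 hf2]] := kernel_positive_off_edge De (in_kernel_comb 1 (-1) hK zK).
  by rewrite ze; lia.
apply: (robust_no_splitting (f1 := f1) (f2 := f2) robust zK hK zgen) => //.
- move=> f Df zf; have [->|ne] := eqVneq f e; first exact: ltW.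
  by case: (hz f Df ne) => ->; rewrite ?zf.
- move=> f Df zf; apply: hz => //; apply: contraNneq zf => ->; exact/eqP.
- by case: (hz f1 Df1 ne1) => // hf0; rewrite hf0 in hf1.
- by case: (hz f1 Df1 ne1) => hf0; rewrite hf0 // in hf1.
- by case: (hz f2 Df2 ne2) => // hf0; rewrite hf0 in hf2; lia.
- case: (hz f2 Df2 ne2) => hf0; rewrite hf0 in hf2; lia.
Qed.

(** [E1] plays the balanced cycle and [E2] the rest, meeting only along [e]. The first rigidity
    hypothesis says that one entry determines a vector on [E1] minus [e]; the second, that no
    nonzero kernel vector lives on [E2] minus [e]. Hence the kernel vectors on the union that vanish
    at [e] have rank one, and a generator [z] is a circuit that splits at [e]. *)
Lemma robust_no_gluing (e f1 : T * T) (E1 E2 : {set T * T}) (c1 c2 : T * T -> int) :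
  e \in edges D -> E1 \subset edges D -> E1 :&: E2 = [set e] ->
  (forall x, x \in vertices D -> x != e.1 -> x != e.2 ->
     {in E1, forall f, incidence_entry D x f = 0%N}
     \/ {in E2, forall f, incidence_entry D x f = 0%N}) ->
  in_kernel D c1 -> in_kernel D c2 ->
  (forall f, f \notin E1 -> c1 f = 0) -> (forall f, f \notin E2 -> c2 f = 0) ->
  c1 e != 0 -> c2 e != 0 -> f1 \in E1 -> f1 != e ->
  (forall y, (forall x, x \in vertices D -> x != e.1 -> x != e.2 ->
       \sum_(f in E1) (incidence_entry D x f)%:Z * y f = 0) ->
     y f1 = 0 -> forall f, f \in E1 -> f != e -> y f = 0) ->
  (forall y, in_kernel D y -> (forall f, f \in edges D -> f \notin E2 :\ e -> y f = 0) ->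
     forall f, f \in edges D -> y f = 0) ->
  False.
Proof.
move=> De sE1 E12 HV c1K c2K c1E c2E c1e c2e E1f1 ne1 rigid1 rigid2.
have /andP[De1 _] := edge_ends De.
have [E1e E2e] : e \in E1 /\ e \in E2.
  by apply/andP; rewrite -in_setI E12 set11.
have notE2 f : f \in E1 -> f != e -> f \notin E2.
  by move=> E1f ne; apply: contra ne => E2f; rewrite -in_set1 -E12 inE E1f.
(* At a vertex off [e] the edges of at most one side are incident, so the balance equation restricts
   to [E1]. *)
have inner y : in_kernel D y -> (forall f, f \in edges D -> f \notin E1 :|: E2 -> y f = 0) ->
    forall x, x \in vertices D -> x != e.1 -> x != e.2 ->
    \sum_(f in E1) (incidence_entry D x f)%:Z * y f = 0.
  move=> yK yE x xD x1 x2; have [E1x|E2x] := HV x xD x1 x2.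
    by apply: big1 => f E1f; rewrite E1x // mul0r.
  have := yK x xD; rewrite (big_setID E1) /= (setIidPr sE1) [X in _ + X]big1 ?addr0 // => f.
  rewrite inE => /andP[nE1 Df]; have [E2f|nE2] := boolP (f \in E2).
    by rewrite E2x // mul0r.
  by rewrite yE ?mulr0 // inE negb_or nE1.
have suppE1 f : f \in edges D -> f \notin E1 :|: E2 -> c1 f = 0.
  by move=> _; rewrite inE negb_or => /andP[/c1E].
have suppE2 f : f \in edges D -> f \notin E1 :|: E2 -> c2 f = 0.
  by move=> _; rewrite inE negb_or => /andP[_ /c2E].
have c1f1 : c1 f1 != 0.
  apply/eqP => c10; have [f [Df ne]] := kernel_positive_off_edge De c1K c1e.
  have [E1f|/c1E->//] := boolP (f \in E1).
  by rewrite (rigid1 c1) //; apply: inner.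
pose N y := [/\ in_kernel D y, forall f, f \in edges D -> f \notin E1 :|: E2 -> y f = 0
   & y e = 0].
have Ncomb y z c d : N y -> N z -> N (fun f => c * y f + d * z f).
  move=> [yK yE ye] [zK zE ze]; split; first exact: in_kernel_comb.
    by move=> f Df nf; rewrite (yE f) // (zE f) // !mulr0.
  by rewrite ye ze !mulr0.
(* Evaluation at [f1] is injective on [N]: a zero there clears [E1], which leaves a vector on [E2]
   minus [e]. *)
have N0 y : N y -> y f1 = 0 -> forall f, f \in edges D -> y f = 0.
  move=> [yK yE ye] yf1; apply: rigid2 => // f Df nf.
  have [->//|ne] := eqVneq f e; have [E1f|nE1] := boolP (f \in E1).
    by apply: (rigid1 y) => //; apply: inner.
  by apply: yE => //; move: nf; rewrite !inE negb_or nE1 ne.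
have [z [Nz zf1 zgen]] : exists z, [/\ N z, z f1 != 0
    & forall y, N y -> exists k, forall f, f \in edges D -> y f = k * z f].
  (* The combination of [c1] and [c2] that cancels at [e]; it is nonzero at [f1], where only [c1]
     lives. *)
  pose z0 f := c2 e * c1 f + - c1 e * c2 f.
  have Nz0 : N z0.
    split; first exact: in_kernel_comb; last by rewrite /z0 mulNr mulrC subrr.
    by move=> f Df nf; rewrite /z0 (suppE1 f) // (suppE2 f) // !mulr0.
  have z0f1 : z0 f1 != 0 by rewrite /z0 (c2E f1) ?notE2 // mulr0 addr0 mulf_neq0.
  (* Euclidean descent on the absolute value at [f1]: if [z f1] does not divide some [y f1], the
     remainder is attained by another element of [N]. *)
  elim: {z0}_.+1 {-2}z0 (ltnSn `|z0 f1|%N) Nz0 z0f1 => // d IHd z; rewrite ltnS => le_zd Nz zf1.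
  have [zdvd|] := classic (forall y, N y -> (z f1 %| y f1)%Z).
    exists z; split=> // y Ny; have /dvdzP[k yk] := zdvd y Ny; exists k => f Df.
    apply/eqP; rewrite -subr_eq0 -mulNr -{1}[y f]mul1r; apply/eqP.
    by apply: (N0 _ (Ncomb _ _ 1 (- k) Ny Nz)) => //; rewrite yk mul1r mulNr subrr.
  move=> notall; have [y nimp] := not_all_ex_not _ _ notall.
  have [Ny ndvd] := imply_to_and _ _ nimp.
  have e1 : 1 * y f1 + - (y f1 %/ z f1)%Z * z f1 = (y f1 %% z f1)%Z.
    by rewrite /modz mul1r mulNr.
  apply: (IHd _ _ (Ncomb _ _ 1 (- (y f1 %/ z f1)%Z) Ny Nz)); rewrite e1.
    have := ltz_mod (y f1) zf1; have := modz_ge0 (y f1) zf1; move: le_zd; clear; lia.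
  by apply/eqP => m0; apply: ndvd; apply/dvdz_mod0P.
have [zK zE ze] := Nz.
(* The entry of [e] at its tail is 1, so [z] restricted to [E1] extends integrally to [e]. *)
pose t := - \sum_(f in E1 | f != e) (incidence_entry D e.1 f)%:Z * z f.
pose h f := if f == e then t else if f \in E1 then z f else 0.
(* The cross combination of [z] and [c1] vanishes at [f1], hence on all of [E1] minus [e]. *)
have prop f : f \in E1 -> f != e -> c1 f1 * z f = z f1 * c1 f.
  move=> E1f ne; apply/eqP; rewrite -subr_eq0 -mulNr; apply/eqP.
  apply: (rigid1 (fun f => c1 f1 * z f + - z f1 * c1 f)) => //; last first.
    by rewrite mulNr [c1 f1 * _]mulrC subrr.
  apply: inner; first exact: in_kernel_comb.
  by move=> g Dg ng; rewrite (zE g) // (suppE1 g) // !mulr0.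
(* At [e] this is the balance equation of [c1] at the tail of [e]. So [h] is a rational multiple of
   [c1], and therefore in the kernel. *)
have hc1 g : c1 f1 * h g = z f1 * c1 g.
  rewrite /h; have [->|ne] := eqVneq g e; last first.
    by case: ifP => [E1f|/negbT/c1E->]; rewrite ?mulr0 ?prop.
  have := c1K _ De1; rewrite (big_setID E1) /= (setIidPr sE1) [X in _ + X]big1 ?addr0; last first.
    by move=> f; rewrite inE => /andP[/c1E-> _]; rewrite mulr0.
  rewrite (bigD1 e) //= {1}/incidence_entry eqxx mul1r => /eqP.
  rewrite addr_eq0 => /eqP->; rewrite /t !mulrN !mulr_sumr; congr (- _).
  by apply: eq_bigr => f /andP[E1f ne]; rewrite mulrCA prop // mulrCA.
have hK : in_kernel D h.
  move=> x xD; apply: (mulfI c1f1); rewrite mulr0 mulr_sumr.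
  under eq_bigr => f _ do rewrite mulrCA hc1 mulrCA.
  by rewrite -mulr_sumr c1K // mulr0.
have he : h e != 0.
  by apply: contraTneq (mulf_neq0 zf1 c1e) => he; rewrite -hc1 he mulr0 eqxx.
have hz f : f \in edges D -> f != e -> h f = 0 \/ h f = z f.
  by move=> _ ne; rewrite /h (negPf ne); case: ifP; [right|left].
have zgen' y : in_kernel D y -> (forall f, f \in edges D -> z f = 0 -> y f = 0) ->
    exists k, forall f, f \in edges D -> y f = k * z f.
  by move=> yK yz; apply: zgen; split=> // [f Df nf|]; apply: yz => //; apply: zE.
(* If [h e] is negative, both [z] and [h] are negated. *)
have [he_lt|he_gt|/eqP] := ltrgtP (h e) 0; last by rewrite (negPf he).
  apply: (@no_split_circuit e (fun f => - z f) (fun f => - h f)) => //.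
  - exact: in_kernelN.
  - exact: in_kernelN.
  - by rewrite ze oppr0.
  - by rewrite oppr_gt0.
  - by move=> f Df ne; case: (hz f Df ne) => ->; rewrite ?oppr0; [left|right].
  move=> y yK yz; have [|k Hk] := zgen' y yK.
    by move=> f Df zf; apply: yz => //; rewrite zf oppr0.
  by exists (- k) => f Df; rewrite mulrNN Hk.
exact: (@no_split_circuit e z h).
Qed.

End Core.

(** After rotating [a] to the front, the remaining list is a path on which [P] propagates in both
    directions. *)
Lemma next_pred_const (T : eqType) (P : T -> Prop) (s : seq T) a :
  uniq s -> a \in s ->
  (forall u, u \in s -> u != a -> next s u != a -> P u <-> P (next s u)) ->
  forall u v, u \in s -> v \in s -> u != a -> v != a -> P u -> P v.
Proof.
move=> s_uniq /rot_to[i t rot_s] step u v.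
have next_s x : next s x = next (a :: t) x by rewrite -rot_s next_rot.
have mem_s x : (x \in s) = (x \in a :: t) by rewrite -rot_s mem_rot.
have := s_uniq; rewrite -(rot_uniq i) rot_s => t_uniq.
have {}step x : x \in t -> next (a :: t) x \in t -> P x <-> P (next (a :: t) x).
  have /andP[a_notin _] : (a \notin t) && uniq t by [].
  move=> tx tnx; rewrite -next_s; apply: step.
  - by rewrite mem_s inE tx orbT.
  - by apply: contraNneq a_notin => <-.
  - by rewrite next_s; apply: contraNneq a_notin => <-.
rewrite !mem_s !inE => tu tv /negPf nu /negPf nv; move: tu tv; rewrite nu nv /=.
have := cycle_next t_uniq; move: step {mem_s next_s nu nv t_uniq rot_s}.
move: (next (a :: t)) => n step; rewrite /= rcons_path => /andP[+ _].
case: t step => [|c t] // step /= /andP[_ path_t].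
suff eqc w : w \in c :: t -> P c <-> P w.
  by move=> /eqc[_ uc] /eqc[cv _] /uc.
elim: t c path_t step w => [|d t IHt] c /= path_t step w; first by rewrite inE => /eqP->.
case/andP: path_t => /eqP nc path_t; rewrite inE => /orP[/eqP->//|tw].
have := step c; rewrite nc !inE !eqxx orbT => /(_ isT isT) ->; apply: IHt tw => // x tx tnx.
by apply: step; rewrite inE ?tx ?tnx orbT.
Qed.

(** * Edges of a cycle and rigidity of edge vectors on it *)

Section Cycles.
Variables (T : finType).
Implicit Types (C D H : wograph T) (s : seq T) (x u v : T) (e f : T * T).
Implicit Types (y : T * T -> int).

Lemma next_neq s u : uniq s -> (3 <= size s)%N -> u \in s ->
  next s u != u /\ next s (next s u) != u.
Proof.
move=> s_uniq s3 /rot_to[i t rot_s].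
have := s_uniq; rewrite -(rot_uniq i) rot_s -!(next_rot i s_uniq) rot_s.
have := s3; rewrite -(size_rot i) rot_s.
case: t {rot_s} => [|b [|c t]] //= _; rewrite !inE !negb_or -!andbA.
case/and4P=> ub uc _ _; rewrite eqxx; split; first by rewrite eq_sym.
by rewrite eq_sym in ub; rewrite (negPf ub) eqxx eq_sym.
Qed.

Definition cycle_edge C s u : T * T :=
  if (u, next s u) \in edges C then (u, next s u) else (next s u, u).

Definition cycle_enum C s : Prop :=
  [/\ uniq s, (3 <= size s)%N, vertices C = [set x in s]
    & forall u v, adjacent C u v =
        [&& u \in s, v \in s & (next s u == v) || (next s v == u)]].

Section Enumeration.
Variables (C : wograph T) (s : seq T) (Cs : cycle_enum C s).

Lemma cycle_edge_in u : u \in s -> cycle_edge C s u \in edges C.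
Proof.
have [_ _ _ adj] := Cs => su; rewrite /cycle_edge.
have := adj u (next s u); rewrite su mem_next su eqxx /= /adjacent.
by case: ifP.
Qed.

Lemma cycle_edge_surj f : f \in edges C -> exists2 u, u \in s & f = cycle_edge C s u.
Proof.
have [_ _ _ adj] := Cs; case: f => a b Cab.
have := adj a b; rewrite /adjacent Cab /= => /esym/and3P[sa sb /orP[/eqP nab|/eqP nba]].
  by exists a; rewrite // /cycle_edge nab Cab.
by exists b; rewrite // /cycle_edge nba (negPf (no_antiparallel Cab)).
Qed.

Lemma cycle_edge_ends u x :
  (x == (cycle_edge C s u).1) || (x == (cycle_edge C s u).2) = (x == u) || (x == next s u).
Proof. by rewrite /cycle_edge; case: ifP => //= _; rewrite orbC. Qed.

(** Two vertices with the same edge would be each other's successors, which length at least three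
    rules out. *)
Lemma cycle_edge_inj : {in s &, injective (cycle_edge C s)}.
Proof.
have [s_uniq s3 _ _] := Cs => u v su sv euv.
have := cycle_edge_ends u u; rewrite euv cycle_edge_ends eqxx /= => /orP[/eqP//|/eqP unv].
have := cycle_edge_ends v v; rewrite -euv cycle_edge_ends eqxx /= => /orP[/eqP//|/eqP vnu].
by have [_] := next_neq s_uniq s3 su; rewrite -vnu -unv eqxx.
Qed.

Lemma cycle_card : #|edges C| = #|vertices C| /\ (3 <= #|edges C|)%N.
Proof.
have [s_uniq s3 vC _] := Cs.
have -> : edges C = [set cycle_edge C s u | u in s].
  apply/setP => f; apply/idP/imsetP => [/cycle_edge_surj[u su ->]|[u su ->]]; first by exists u.
  exact: cycle_edge_in.
have -> : #|vertices C| = #|s| by rewrite vC cardsE.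
by rewrite card_in_imset; [rewrite (card_uniqP s_uniq) | exact: cycle_edge_inj].
Qed.

(** Deleting [e] leaves a path. At each inner vertex exactly two edges meet, both with nonzero
    incidence entry, so one value vanishes iff the other does; [next_pred_const] carries this along
    the path. *)
Lemma cycle_rigid_enum D e f1 y : subgraph C D ->
  e \in edges C -> f1 \in edges C -> f1 != e ->
  (forall x, x \in vertices D -> x != e.1 -> x != e.2 ->
     \sum_(f in edges C) (incidence_entry D x f)%:Z * y f = 0) ->
  y f1 = 0 -> forall f, f \in edges C -> f != e -> y f = 0.
Proof.
have [s_uniq s3 vC _] := Cs => -[sV sE _] Ce Cf1 ne1 inner yf1 f Cf ne.
have [a sa ea] := cycle_edge_surj Ce; have [u1 su1 eu1] := cycle_edge_surj Cf1.
have [u su eu] := cycle_edge_surj Cf.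
have next_inj : injective (next s) := can_inj (prev_next s_uniq).
pose zero v := y (cycle_edge C s v) = 0.
rewrite eu; apply: (@next_pred_const _ zero s a s_uniq sa _ u1 u) => //; rewrite /zero.
- move=> w sw nwa nnw; set x := next s w.
  have sx : x \in s by rewrite mem_next.
  have xD : x \in vertices D by apply: (subsetP sV); rewrite vC inE.
  have xe : ~~ ((x == e.1) || (x == e.2)).
    by rewrite ea cycle_edge_ends negb_or nnw (inj_eq next_inj) nwa.
  have /andP[x1 x2] : (x != e.1) && (x != e.2) by rewrite -negb_or.
  have nxw : x != w by have [] := next_neq s_uniq s3 sw.
  have ne_xw : cycle_edge C s x != cycle_edge C s w.
    by apply: contra nxw => /eqP/cycle_edge_inj-> //.
  have := inner x xD x1 x2; rewrite (bigD1 (cycle_edge C s w)) ?cycle_edge_in //=.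
  (* Apart from the edges named by [w] and by [x], its successor, no edge of the cycle touches
     [x]. *)
  rewrite (bigD1 (cycle_edge C s x)) ?cycle_edge_in ?ne_xw //= big1 ?addr0; last first.
    move=> _ /andP[/andP[/cycle_edge_surj[v sv ->] nvw] nvx].
    have := incidence_entry_neq0 (cycle_edge C s v) xD; rewrite cycle_edge_ends.
    rewrite (inj_eq next_inj) [x == v]eq_sym [w == v]eq_sym.
    have -> : (v == x) = false by apply: contraNF nvx => /eqP->.
    have -> : (v == w) = false by apply: contraNF nvw => /eqP->.
    by move/negbFE/eqP->; rewrite mul0r.
  have := incidence_entry_neq0 (cycle_edge C s x) xD; rewrite cycle_edge_ends eqxx.
  have := incidence_entry_neq0 (cycle_edge C s w) xD; rewrite cycle_edge_ends eqxx orbT.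
  move: (incidence_entry D x _) (incidence_entry D x _) => p q p0 q0 pq0.
  by split=> y0; move: pq0; rewrite y0 mulr0 ?add0r ?addr0 => /eqP;
     rewrite mulf_eq0 eqz_nat ?(negPf p0) ?(negPf q0) => /eqP.
- by apply: contraNneq ne1 => e1; rewrite eu1 e1 -ea.
- by apply: contraNneq ne => e1; rewrite eu e1 -ea.
- by rewrite -eu1.
Qed.

End Enumeration.

Lemma cycle_rigid C D e f1 y : is_cycle C -> subgraph C D ->
  e \in edges C -> f1 \in edges C -> f1 != e ->
  (forall x, x \in vertices D -> x != e.1 -> x != e.2 ->
     \sum_(f in edges C) (incidence_entry D x f)%:Z * y f = 0) ->
  y f1 = 0 -> forall f, f \in edges C -> f != e -> y f = 0.
Proof. by move=> [s Cs]; apply: (cycle_rigid_enum Cs). Qed.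

Lemma card_cycle C : is_cycle C -> #|edges C| = #|vertices C| /\ (3 <= #|edges C|)%N.
Proof. by move=> [s Cs]; apply: (cycle_card Cs). Qed.

Lemma cycle_third_edge C e f : is_cycle C ->
  exists g, [/\ g \in edges C, g != e & g != f].
Proof.
move=> /card_cycle[_ E3]; have /card_gt0P[g] : (0 < #|edges C :\ e :\ f|)%N.
  move: E3; rewrite (cardsD1 e) (cardsD1 f (edges C :\ e)).
  by case: (e \in _) (f \in _) => [] []; case: #|_| => [|k].
by rewrite !inE => /and3P[gf ge gC]; exists g.
Qed.

Lemma subgraph_refl D : subgraph D D. Proof. by split. Qed.

Lemma subgraph_trans C H D : subgraph C H -> subgraph H D -> subgraph C D.
Proof.
move=> [CV CE Cw] [HV HE Hw]; split; [exact: subset_trans HV | exact: subset_trans HE|].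
by move=> x Cx; rewrite Cw // Hw // (subsetP CV).
Qed.

(** Rigidity is applied after deleting a third edge [g], so that the remaining path contains both
    [e] and [f]. *)
Lemma cycle_kernel_eq0 C e y : is_cycle C -> in_kernel C y -> e \in edges C -> y e = 0 ->
  forall f, f \in edges C -> y f = 0.
Proof.
move=> cC yK Ce ye f Cf; have [g [Cg ge gf]] := cycle_third_edge e f cC.
apply: (cycle_rigid cC (subgraph_refl C) Cg Ce) => //; try by rewrite eq_sym.
by move=> x xC _ _; apply: yK.
Qed.

Lemma incidence_entry_off D x f :
  x \notin vertices D -> f \in edges D -> forall H, incidence_entry H x f = 0%N.
Proof.
move=> nx /edge_ends/andP[f1 f2] H; rewrite /incidence_entry.
by case: eqP nx => [->|_]; [rewrite f1 | case: eqP => [->|//]; rewrite f2].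
Qed.

(** At vertices of [C] the two balance equations agree; at the other vertices no edge of [C] is
    incident. *)
Lemma in_kernel_subgraph C D y : subgraph C D ->
  (forall f, f \in edges D -> f \notin edges C -> y f = 0) -> in_kernel C y <-> in_kernel D y.
Proof.
move=> [CV CE Cw] off.
have sumE x : \sum_(f in edges D) (incidence_entry D x f)%:Z * y f
    = \sum_(f in edges C) (incidence_entry D x f)%:Z * y f.
  rewrite (big_setID (edges C)) /= (setIidPr CE) [X in _ + X]big1 ?addr0 // => f.
  by rewrite inE => /andP[nf Df]; rewrite off // mulr0.
have sumC x : x \in vertices C -> \sum_(f in edges C) (incidence_entry D x f)%:Z * y f
    = \sum_(f in edges C) (incidence_entry C x f)%:Z * y f.
  by move=> Cx; apply: eq_bigr => f _; rewrite /incidence_entry Cw.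
split=> [yK x xD|yK x Cx]; last by rewrite -sumC // -sumE yK // (subsetP CV).
rewrite sumE; have [Cx|nx] := boolP (x \in vertices C); first by rewrite sumC // yK.
by apply: big1 => f Cf; rewrite (incidence_entry_off nx) // mul0r.
Qed.

End Cycles.

(** * Integral kernel vectors of singular and of wide matrices *)

Section IntegerKernels.

Lemma det_castmx_eq0P (p q : nat) (M : 'M[int]_(p, q)) (eqp : q = p) :
  \det (castmx (erefl p, eqp) M) = 0 <-> exists2 w : 'cV_q, w != 0 & M *m w = 0.
Proof.
case: p / eqp M => M; rewrite castmx_id -det_tr.
split=> [/eqP/det0P[v v0 vM]|[w w0 Mw]].
  exists v^T; first by rewrite -(inj_eq trmx_inj) trmxK trmx0.
  by apply: trmx_inj; rewrite trmx_mul trmxK vM trmx0.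
apply/eqP/det0P; exists w^T; first by rewrite -(inj_eq trmx_inj) trmxK trmx0.
by rewrite -trmx_mul Mw trmx0.
Qed.

(** Padding with zero rows gives a square matrix, singular because row [p] is zero. *)
Lemma wide_kernel (p q : nat) (M : 'M[int]_(p, q)) : (p < q)%N ->
  exists2 w : 'cV_q, w != 0 & M *m w = 0.
Proof.
move=> lt_pq.
pose N : 'M[int]_q := \matrix_(i, j) (if insub (val i) is Some i' then M i' j else 0).
have : \det (castmx (erefl q, erefl q) N) = 0.
  rewrite castmx_id; apply/eqP/det0P; exists (delta_mx 0 (Ordinal lt_pq)).
    by apply/eqP => /matrixP/(_ 0 (Ordinal lt_pq)); rewrite !mxE !eqxx.
  by rewrite -rowE; apply/rowP => j; rewrite !mxE insubN //= -leqNgt.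
case/det_castmx_eq0P => w w0 Nw; exists w => //; apply/colP => i.
have Nwi := congr1 (fun v : 'cV_q => v (widen_ord (ltnW lt_pq) i) 0) Nw.
rewrite !mxE in Nwi; rewrite !mxE -[RHS]Nwi.
apply: eq_bigr => j _; rewrite mxE insubT //= => lt_ip; congr (M _ _ * _); exact: val_inj.
Qed.

End IntegerKernels.

(** * Balancedness in terms of kernel vectors *)

Section KernelVectors.
Variable T : finType.
Implicit Types (C D : wograph T) (V : {set T}) (E : {set T * T}) (y : T * T -> int).

Definition incidence_submx D V E : 'M[int]_(#|V|, #|E|) :=
  \matrix_(i, j) (incidence_entry D (enum_val i) (enum_val j))%:Z.

Lemma incidence_submx_kernelP D V E y (w : 'cV_#|E|) :
  (forall j, w j 0 = y (enum_val j)) ->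
  incidence_submx D V E *m w = 0 <->
  forall x, x \in V -> \sum_(f in E) (incidence_entry D x f)%:Z * y f = 0.
Proof.
move=> wy; have key i : (incidence_submx D V E *m w) i 0
    = \sum_(f in E) (incidence_entry D (enum_val i) f)%:Z * y f.
  by rewrite mxE; apply/esym; rewrite big_enum_val; apply: eq_bigr => j _; rewrite mxE wy.
split=> [Mw x Vx|yK]; last by apply/colP => i; rewrite key yK ?mxE // enum_valP.
by have := key (enum_rank_in Vx x); rewrite Mw mxE enum_rankK_in.
Qed.

Lemma kernel_vector D V E (w : 'cV_#|E|) : w != 0 -> incidence_submx D V E *m w = 0 ->
  exists y, [/\ forall x, x \in V -> \sum_(f in E) (incidence_entry D x f)%:Z * y f = 0,
    forall f, f \notin E -> y f = 0 & exists2 f, f \in E & y f != 0].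
Proof.
move=> w0 Mw; pose y f := \sum_(j | enum_val j == f) w j 0.
have wy j : w j 0 = y (enum_val j).
  by rewrite /y (big_pred1 j) // => j'; rewrite /= (inj_eq enum_val_inj).
exists y; split; first exact/(incidence_submx_kernelP D V wy).
  by move=> f nf; apply: big1 => j /eqP ej; rewrite -ej enum_valP in nf.
have [j wj] := cV0Pn _ w0; exists (enum_val j); first exact: enum_valP.
by rewrite -wy.
Qed.

Lemma balanced_kernel C : balanced C ->
  exists y, [/\ in_kernel C y, forall f, f \notin edges C -> y f = 0
    & exists2 f, f \in edges C & y f != 0].
Proof. by case=> eqEV /det_castmx_eq0P[w w0 Mw]; apply: (kernel_vector w0 Mw). Qed.

Lemma unbalanced_kernel_eq0 C y : unbalanced_cycle C -> in_kernel C y ->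
  forall f, f \in edges C -> y f = 0.
Proof.
move=> [cC nbal] yK f Cf; apply: NNPP => /eqP yf; apply: nbal.
have [eqEV _] := card_cycle cC; exists eqEV; apply/det_castmx_eq0P.
pose w : 'cV[int]_#|edges C| := \col_j y (enum_val j).
have wy j : w j 0 = y (enum_val j) by rewrite mxE.
exists w; last exact/(incidence_submx_kernelP C (vertices C) wy).
apply/cV0Pn; exists (enum_rank_in Cf f); by rewrite wy enum_rankK_in.
Qed.

End KernelVectors.

(** * Excluding the two types of subgraphs *)

Section Obstructions.
Variables (K : fieldType) (T : finType) (D : wograph T).
Hypothesis robust : generalized_robust K D \/ weakly_robust K D.
Implicit Types (C H : wograph T) (e : T * T) (E : {set T * T}).

Lemma incidence_off_intersection C (V : {set T}) E e x : subgraph C D ->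
  (forall f, f \in E -> (f.1 \in V) && (f.2 \in V)) -> vertices C :&: V = [set e.1; e.2] ->
  x != e.1 -> x != e.2 ->
  {in edges C, forall f, incidence_entry D x f = 0%N}
  \/ {in E, forall f, incidence_entry D x f = 0%N}.
Proof.
move=> CD EV CV /negPf x1 /negPf x2; have [xC|nx] := boolP (x \in vertices C); [right|left].
  move=> f /EV/andP[f1 f2]; have nV : x \notin V.
    by apply/negP => xV; have := in_set2 x e.1 e.2; rewrite -CV inE xC xV x1 x2.
  rewrite /incidence_entry; case: eqP nV => [->|_]; first by rewrite f1.
  by case: eqP => [->|//]; rewrite f2.
by move=> f Cf; rewrite (incidence_entry_off nx).
Qed.

Lemma balanced_cycle_kernel C : subgraph C D -> balanced_cycle C ->
  exists c, [/\ in_kernel D c, forall f, f \notin edges C -> c f = 0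
    & forall f, f \in edges C -> c f != 0].
Proof.
move=> CD [cC /balanced_kernel[c [cK off [f Cf cf]]]]; exists c; split=> //.
  by apply/(in_kernel_subgraph CD) => // g _; apply: off.
by move=> g Cg; apply: contra cf => /eqP cg; rewrite (cycle_kernel_eq0 cC cK Cg cg).
Qed.

(** The common part of both types: [E2] is the second cycle or the union of the unbalanced ones. The
    value of [c2] at [e] is nonzero, since otherwise [c2] would live on [E2] minus [e]. *)
Lemma robust_no_shared_edge C1 E2 (V2 : {set T}) e c2 : subgraph C1 D -> balanced_cycle C1 ->
  (forall f, f \in E2 -> (f.1 \in V2) && (f.2 \in V2)) ->
  edges C1 :&: E2 = [set e] -> vertices C1 :&: V2 = [set e.1; e.2] ->
  in_kernel D c2 -> (forall f, f \notin E2 -> c2 f = 0) ->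
  (exists2 f, f \in edges D & c2 f != 0) ->
  (forall y, in_kernel D y -> (forall f, f \in edges D -> f \notin E2 :\ e -> y f = 0) ->
     forall f, f \in edges D -> y f = 0) ->
  False.
Proof.
move=> C1D bC1 E2V2 E12 V12 c2K c2E [f2 Df2 c2f2] rigid2.
have [C1V C1E _] := C1D; have [cC1 _] := bC1.
have C1e : e \in edges C1 by have := set11 e; rewrite -E12 inE => /andP[].
have [c1 [c1K c1E c1n0]] := balanced_cycle_kernel C1D bC1.
have [f1 [C1f1 ne1 _]] := cycle_third_edge e e cC1.
apply: (robust_no_gluing robust (e := e) (f1 := f1) (E1 := edges C1) (E2 := E2)
  (c1 := c1) (c2 := c2)) => //.
- exact: (subsetP C1E).
- by move=> x _; apply: incidence_off_intersection V12.
- exact: c1n0.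
- apply: contra c2f2 => /eqP c2e; apply/eqP/rigid2 => // f Df.
  by rewrite !inE negb_and negbK => /orP[/eqP->|/c2E].
- by move=> y; apply: cycle_rigid.
Qed.

Lemma robust_no_D1 H : subgraph H D -> ~ type_D1 H.
Proof.
move=> HD [C1 [C2 [e [[C1H C2H] _ _ [E12 V12] [bC1 bC2]]]]].
have C1D := subgraph_trans C1H HD; have C2D := subgraph_trans C2H HD.
have [c2 [c2K c2E c2n0]] := balanced_cycle_kernel C2D bC2.
have C2e : e \in edges C2 by have := set11 e; rewrite -E12 inE => /andP[].
have [C2V C2E _] := C2D; have [cC2 _] := bC2.
apply: (robust_no_shared_edge C1D bC1 (@edge_ends _ C2) E12 V12 c2K c2E).
  by exists e; [exact: (subsetP C2E) | exact: c2n0].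
(* A kernel vector on the cycle [C2] that vanishes at [e] vanishes throughout. *)
move=> y yK yE f Df; have off g : g \in edges D -> g \notin edges C2 -> y g = 0.
  by move=> Dg ng; rewrite yE // inE negb_and ng orbT.
have [C2f|nf] := boolP (f \in edges C2); last exact: off.
apply: (cycle_kernel_eq0 cC2 _ C2e) => //; first exact/(in_kernel_subgraph C2D).
by apply: yE; [exact: (subsetP C2E) | rewrite !inE eqxx].
Qed.

Lemma robust_no_D2 H : subgraph H D -> ~ type_D2 H.
Proof.
move=> HD [C1 [C' [C'' [e [[C1H C'H C''H] _ _ [[E1' V1'] [E1'' V1''] [E'' V'']]]]]]].
move=> [bC1 [cC' _] [cC'' _] [C3 [C3H C3E uC3]]].
have C1D := subgraph_trans C1H HD; have C'D := subgraph_trans C'H HD.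
have C''D := subgraph_trans C''H HD; have C3D := subgraph_trans C3H HD.
have [C'V C'E _] := C'D; have [C''V C''E _] := C''D.
pose E2 := edges C' :|: edges C''; pose V2 := vertices C' :|: vertices C''.
have sE2 : E2 \subset edges D by rewrite subUset C'E.
have E2V2 f : f \in E2 -> (f.1 \in V2) && (f.2 \in V2).
  by rewrite !inE => /orP[]/edge_ends/andP[-> ->]; rewrite ?orbT.
have E12 : edges C1 :&: E2 = [set e] by rewrite setIUr E1' E1'' setUid.
have V12 : vertices C1 :&: V2 = [set e.1; e.2] by rewrite setIUr V1' V1'' setUid.
have C'e : e \in edges C' by have := set11 e; rewrite -E'' inE => /andP[].
(* The two cycles share one edge but two vertices, so their union has one more edge than vertices
   and carries a nonzero kernel vector. *)
have lt_VE : (#|V2| < #|E2|)%N.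
  have := cardsUI (edges C') (edges C''); have := cardsUI (vertices C') (vertices C'').
  rewrite E'' V'' cards1 cards2 -/E2 -/V2.
  have -> : e.1 != e.2.
    apply: contraTneq C'e => e12; rewrite (surjective_pairing e) e12; exact: loopless.
  have [-> _] := card_cycle cC'; have [-> _] := card_cycle cC''; lia.
have [w w0 Mw] := wide_kernel (incidence_submx D V2 E2) lt_VE.
have [c2 [c2V c2E [f2 E2f2 c2f2]]] := kernel_vector w0 Mw.
apply: (robust_no_shared_edge C1D bC1 E2V2 E12 V12 (c2 := c2)) => //.
- move=> x xD; rewrite (big_setID E2) /= (setIidPr sE2) [X in _ + X]big1 ?addr0; last first.
    by move=> f; rewrite inE => /andP[/c2E-> _]; rewrite mulr0.
  have [/c2V//|nx] := boolP (x \in V2); apply: big1 => f /E2V2/andP[f1 f2'].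
  rewrite /incidence_entry; case: eqP nx => [->|_]; first by rewrite f1.
  by case: eqP => [->|_]; rewrite ?f2' ?mul0r.
- by exists f2 => //; apply: (subsetP sE2).
(* [E2] minus [e] is the edge set of the third unbalanced cycle, which carries no nonzero kernel
   vector. *)
move=> y yK yE f Df; rewrite -C3E in yE.
have [C3f|nf] := boolP (f \in edges C3); last exact: yE.
by apply: (unbalanced_kernel_eq0 uC3) => //; apply/(in_kernel_subgraph C3D).
Qed.

End Obstructions.

Theorem theorem3p20 (K : fieldType) (T : finType) (D : wograph T)
    (robust : generalized_robust K D \/ weakly_robust K D) :
  ~ (exists H : wograph T, subgraph H D /\ type_D1 H)
  /\ ~ (exists H : wograph T, subgraph H D /\ type_D2 H).
Proof.
split=> -[H [HD]]; [exact: (robust_no_D1 robust HD) | exact: (robust_no_D2 robust HD)].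
Qed.
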